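(* Let $\Omega$ be a locally compact Hausdorff space, let $G$ be a group, let $\rho \colon G \to \mathrm{Aut}^+(C_0(\Omega))$ be a positive representation, and define $\pi := p \circ \rho \colon G \to \mathrm{Homeo}(\Omega)$. Then the map $S \mapsto I_S := \{f \in C_0(\Omega) : f(S) = 0\}$, which is a bijection between the closed subsets of $\Omega$ and the closed ideals of $C_0(\Omega)$, restricts to a bijection between the $\pi$-invariant closed subsets $S \subset \Omega$ and the $\rho$-invariant closed ideals of $C_0(\Omega)$. By further restriction, this induces a bijection between the $\pi$-invariant regularly closed subsets of $\Omega$ and the $\rho$-invariant bands of $C_0(\Omega)$, and between the $\pi$-invariant clopen subsets of $\Omega$ and the $\rho$-invariant projection bands of $C_0(\Omega)$.
   Context: $C_0(\Omega)$ is the Banach lattice of real-valued continuous functions on $\Omega$ vanishing at infinity, with the supremum norm; ideals are order ideals. $\mathrm{Aut}^+(C_0(\Omega))$ is the group of lattice automorphisms of $C_0(\Omega)$; a positive representation of $G$ is a group homomorphism $\rho\colon G\to \mathrm{Aut}^+(C_0(\Omega))$, and $\rho_s:=\rho(s)$. $\mathrm{Homeo}(\Omega)$ is the group of homeomorphisms of $\Omega$, identified with a subgroup of $\mathrm{Aut}^+(C_0(\Omega))$ via $\phi x:=x\circ\phi^{-1}$. $C_b(\Omega)^{++}$ is the set of bounded continuous functions $m$ on $\Omega$ with $m\ge\delta$ pointwise for some $\delta>0$, identified with multiplication operators. Every $T\in\mathrm{Aut}^+(C_0(\Omega))$ can be written uniquely as $T=m\phi$ with $m\in C_b(\Omega)^{++}$,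 $\phi\in\mathrm{Homeo}(\Omega)$, and $p(m\phi):=\phi$ defines a group homomorphism $p\colon \mathrm{Aut}^+(C_0(\Omega))\to\mathrm{Homeo}(\Omega)$. A subset $S\subset\Omega$ is $\pi$-invariant if $\pi_s(S)\subset S$ for all $s\in G$; a subspace of $C_0(\Omega)$ is $\rho$-invariant if it is mapped into itself by all $\rho_s$. A set $S\subset\Omega$ is regularly closed if $S=\overline{\mathrm{int}(S)}$. *)

(* Defs.v *)
From HB Require Import structures.
From mathcomp Require Import all_boot all_order all_algebra.
From mathcomp Require Import all_classical all_reals all_analysis.

Set Implicit Arguments.
Unset Strict Implicit.
Unset Printing Implicit Defensive.

Import Order.TTheory GRing.Theory Num.Theory.
Import numFieldNormedType.Exports.

Local Open Scope classical_set_scope.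
Local Open Scope ring_scope.

Definition vanishes_at_infinity (R : realType) (Omega : topologicalType)
    (f : Omega -> R) :=
  forall e : R, 0 < e -> compact [set x | e <= `|f x|].

Definition is_C0 (R : realType) (Omega : topologicalType) (f : Omega -> R) :=
  continuous f /\ vanishes_at_infinity f.

Definition C0_pred (R : realType) (Omega : topologicalType) :
  pred (Omega -> R) := fun f => `[< is_C0 f >].

Record C0 (R : realType) (Omega : topologicalType) := MkC0 {
  C0_val :> Omega -> R;
  C0_valP : C0_pred C0_val }.

HB.instance Definition _ (R : realType) (Omega : topologicalType) :=
  [isSub for @C0_val R Omega].
HB.instance Definition _ (R : realType) (Omega : topologicalType) :=
  [Choice of C0 R Omega by <:].

Section C0_lmodule.
Context (R : realType) (Omega : topologicalType).
Implicit Types f g : Omega -> R.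

Lemma vanishes_le2 f g h : continuous h ->
    (forall x, `|h x| <= `|f x| + `|g x|) ->
  vanishes_at_infinity f -> vanishes_at_infinity g -> vanishes_at_infinity h.
Proof.
move=> ch hfg vf vg e e0.
have e20 : 0 < e / 2 by rewrite divr_gt0.
apply: (subclosed_compact _ (compactU (vf _ e20) (vg _ e20))).
  rewrite (_ : mkset _ = (fun x => `|h x|) @^-1` [set y | e <= y])//.
  apply: (preimage_closed _ (@closed_ge _ e)) => x _.
  by apply: continuous_comp; [exact: ch|exact: norm_continuous].
move=> x /= ehx; have [?|fx] := leP (e / 2) `|f x|; first by left.
right; rewrite leNgt; apply/negP => gx.
have := le_lt_trans (le_trans ehx (hfg x)) (ltrD fx gx).
by rewrite -splitr ltxx.
Qed.

Lemma is_C0_0 : is_C0 (0 : Omega -> R).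
Proof.
split=> [x|e e0]; first exact: cvg_cst.
rewrite (_ : mkset _ = set0); first exact: compact0.
by apply/seteqP; split=> x //=; rewrite normr0 leNgt e0.
Qed.

Lemma is_C0_lin (a : R) f g : is_C0 f -> is_C0 g -> is_C0 (a *: f + g).
Proof.
move=> [cf vf] [cg vg].
have caf : continuous (a *: f).
  by move=> x; apply: cvgM; [exact: cvg_cst|exact: cf].
have c : continuous (a *: f + g).
  by move=> x; apply: cvgD; [exact: caf|exact: cg].
split=> //; apply: (vanishes_le2 (f := a *: f) (g := g)) => //.
  by move=> x; exact: ler_normD.
move=> e e0; have [a0|a0] := eqVneq a 0.
  rewrite a0 scale0r (_ : mkset _ = set0); first exact: compact0.
  by apply/seteqP; split=> x //=; rewrite normr0 leNgt e0.
have na0 : 0 < `|a| by rewrite normr_gt0.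
have := vf (e / `|a|) (divr_gt0 e0 na0).
congr compact; apply/seteqP; split=> x /=.
  by rewrite ler_pdivrMr// mulrC -normrM.
by rewrite ler_pdivrMr// mulrC -normrM.
Qed.

Lemma C0_submod_closed : submod_closed (@C0_pred R Omega).
Proof.
split=> [|a f g /asboolP fC /asboolP gC]; apply/asboolP; first exact: is_C0_0.
exact: is_C0_lin.
Qed.

HB.instance Definition _ :=
  GRing.isSubmodClosed.Build R (Omega -> R) (@C0_pred R Omega)
    C0_submod_closed.

End C0_lmodule.

HB.instance Definition _ (R : realType) (Omega : topologicalType) :=
  [SubChoice_isSubLmodule of C0 R Omega by <:].

Section C0_lattice.
Context (R : realType) (Omega : topologicalType).
Implicit Types f g h : C0 R Omega.

Lemma C0P f : is_C0 (f : Omega -> R).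
Proof. exact/asboolP/(C0_valP f). Qed.

Lemma C0_ext f g : (forall x, f x = g x) -> f = g.
Proof. by move=> fg; apply/val_inj/funext. Qed.

Definition C0_le f g := `[< forall x, f x <= g x >].

Let C0_le_refl : reflexive C0_le.
Proof. by move=> f; apply/asboolP => x. Qed.

Let C0_le_anti : antisymmetric C0_le.
Proof.
move=> f g /andP[/asboolP fg /asboolP gf]; apply: C0_ext => x.
by apply/eqP; rewrite eq_le fg gf.
Qed.

Let C0_le_trans : transitive C0_le.
Proof.
move=> g f h /asboolP fg /asboolP gh; apply/asboolP => x.
exact: le_trans (fg x) (gh x).
Qed.

HB.instance Definition _ := Order.Le_isPOrder.Build ring_display (C0 R Omega)
  C0_le_refl C0_le_anti C0_le_trans.

Lemma C0_leP f g : reflect (forall x, f x <= g x) (f <= g).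
Proof. exact: asboolP. Qed.

Lemma is_C0_max f g : is_C0 (fun x => Num.max (f x) (g x)).
Proof.
have [cf vf] := C0P f; have [cg vg] := C0P g.
have c : continuous (fun x => Num.max (f x) (g x)).
  by move=> x; apply: continuous_max; [exact: cf|exact: cg].
split=> //; apply: (vanishes_le2 c _ vf vg) => x.
by rewrite maxElt; case: ifP => _; rewrite ?lerDr ?lerDl.
Qed.

Lemma is_C0_min f g : is_C0 (fun x => Num.min (f x) (g x)).
Proof.
have [cf vf] := C0P f; have [cg vg] := C0P g.
have c : continuous (fun x => Num.min (f x) (g x)).
  by move=> x; apply: continuous_min; [exact: cf|exact: cg].
split=> //; apply: (vanishes_le2 c _ vf vg) => x.
by rewrite minElt; case: ifP => _; rewrite ?lerDr ?lerDl.
Qed.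

Definition C0_join f g : C0 R Omega := MkC0 (asboolT (is_C0_max f g)).
Definition C0_meet f g : C0 R Omega := MkC0 (asboolT (is_C0_min f g)).

Let C0_meetP f g h : (f <= C0_meet g h) = (f <= g) && (f <= h).
Proof.
apply/C0_leP/andP => [fgh|[/C0_leP fg /C0_leP fh] x]; last first.
  by rewrite /= le_min fg fh.
by split; apply/C0_leP => x; have := fgh x; rewrite /= le_min => /andP[].
Qed.

Let C0_joinP f g h : (C0_join f g <= h) = (f <= h) && (g <= h).
Proof.
apply/C0_leP/andP => [fgh|[/C0_leP fh /C0_leP gh] x]; last first.
  by rewrite /= ge_max fh gh.
by split; apply/C0_leP => x; have := fgh x; rewrite /= ge_max => /andP[].
Qed.

HB.instance Definition _ := Order.POrder_MeetJoin_isLattice.Build ring_display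
  (C0 R Omega) C0_meetP C0_joinP.

End C0_lattice.

Section C0_normed.
Context (R : realType) (Omega : topologicalType).
Implicit Types f g : C0 R Omega.

Definition C0_norm f : R := sup (range (fun x => `|f x|)).

Lemma C0_has_ubound f : has_ubound (range (fun x => `|f x|)).
Proof.
have [cf vf] := C0P f.
have cnf : {within [set x | 1 <= `|f x|], continuous (fun x => `|f x|)}.
  apply: continuous_subspaceT => x.
  by apply: continuous_comp; [exact: cf|exact: norm_continuous].
have /compact_bounded[M [_ MP]] :=
  continuous_compact cnf (vf _ (@ltr01 R)).
exists (Num.max 1 (M + 1)) => _ [x _ <-].
have [fx1|/ltW fx1] := leP 1 `|f x|; last by rewrite le_max fx1.
rewrite le_max; apply/orP; right.
have M1 : M < M + 1 by rewrite ltrDl.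
by have := MP _ M1 _ (ex_intro2 _ _ x fx1 erefl); rewrite /= normr_id.
Qed.

Lemma C0_norm_ub f x : `|f x| <= C0_norm f.
Proof. by apply: (ub_le_sup (C0_has_ubound f)); exists x. Qed.

Lemma C0_norm_ge0 f : 0 <= C0_norm f.
Proof.
have [E|/set0P[_ [x _ _]]] := eqVneq (range (fun x => `|f x|)) set0.
  by rewrite /C0_norm E sup0.
exact: le_trans (normr_ge0 _) (C0_norm_ub f x).
Qed.

Lemma C0_norm_le f (M : R) :
  0 <= M -> (forall x, `|f x| <= M) -> C0_norm f <= M.
Proof.
move=> M0 fM; rewrite /C0_norm.
have [->|/set0P ne0] := eqVneq (range (fun x => `|f x|)) set0.
  by rewrite sup0.
by apply: ge_sup => // _ [x _ <-].
Qed.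

Let C0_ler_normD f g : C0_norm (f + g) <= C0_norm f + C0_norm g.
Proof.
apply: C0_norm_le => [|x]; first by rewrite addr_ge0 ?C0_norm_ge0.
by apply: le_trans (ler_normD _ _) _; apply: lerD; exact: C0_norm_ub.
Qed.

Let C0_normrZ (a : R) f : C0_norm (a *: f) = `|a| * C0_norm f.
Proof.
have le1 b h : C0_norm (b *: h) <= `|b| * C0_norm h.
  apply: C0_norm_le => [|x]; first by rewrite mulr_ge0 ?C0_norm_ge0.
  by rewrite [X in `|X|]/(b * h x) normrM ler_wpM2l ?C0_norm_ub.
apply/eqP; rewrite eq_le le1/=.
have [->|a0] := eqVneq a 0; first by rewrite normr0 mul0r C0_norm_ge0.
rewrite -ler_pdivlMl ?normr_gt0// -normfV.
by rewrite -{1}[f](scalerK a0) le1.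
Qed.

Let C0_normr0_eq0 f : C0_norm f = 0 -> f = 0.
Proof.
move=> f0; apply: C0_ext => x.
by apply/normr0_eq0/eqP; rewrite eq_le normr_ge0 -f0 C0_norm_ub.
Qed.

HB.instance Definition _ := Lmodule_isNormed.Build R (C0 R Omega)
  C0_ler_normD C0_normrZ C0_normr0_eq0.

End C0_normed.

Section ideals.
Context (R : realType) (Omega : topologicalType).
Local Notation E := (C0 R Omega).
Implicit Types (f g : E) (I B D : set E).

Definition C0_abs f : E := (f `|` - f)%O.

Definition order_ideal I :=
  [/\ I 0,
      forall f g, I f -> I g -> I (f + g),
      forall (a : R) f, I f -> I (a *: f) &
      forall f g, I g -> C0_abs f <= C0_abs g -> I f].

Definition closed_ideal I := order_ideal I /\ closed I.

Definition band B :=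
  order_ideal B /\ forall D f, D `<=` B -> supremums D f -> B f.

Definition disjoint_complement B : set E :=
  [set f | forall g, B g -> (C0_abs f `&` C0_abs g)%O = 0].

Definition projection_band B := band B /\
  forall f, exists g h, [/\ B g, disjoint_complement B h & f = g + h].

Definition vanishing_ideal (S : set Omega) : set E :=
  [set f | forall x, S x -> f x = 0].

End ideals.

Section lattice_automorphisms.
Context (R : realType) (Omega : topologicalType).
Local Notation E := (C0 R Omega).

Definition is_lattice_aut (T : E -> E) :=
  [/\ forall (a : R) f g, T (a *: f + g) = a *: T f + T g,
      {morph T : f g / (f `|` g)%O},
      {morph T : f g / (f `&` g)%O} &
      bijective T].

Record lattice_aut := MkLatticeAut {
  lattice_aut_val :> E -> E;
  lattice_autP : `[< is_lattice_aut lattice_aut_val >] }.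

HB.instance Definition _ := [isSub for lattice_aut_val].
HB.instance Definition _ := [Choice of lattice_aut by <:].

Implicit Types T U V : lattice_aut.

Lemma lattice_aut_ext T U : T =1 U -> T = U.
Proof. by move=> TU; apply/val_inj/funext. Qed.

Lemma is_lattice_aut_id : is_lattice_aut id.
Proof. by split=> //; exact: (Bijective (g := id)). Qed.

Lemma is_lattice_aut_comp T U : is_lattice_aut (T \o U).
Proof.
have /asboolP[Tl Tj Tm Tb] := lattice_autP T.
have /asboolP[Ul Uj Um Ub] := lattice_autP U.
split=> [a f g|f g|f g|] /=; first by rewrite Ul Tl.
- by rewrite Uj Tj.
- by rewrite Um Tm.
- exact: bij_comp.
Qed.

Lemma lattice_aut_has_inv T :
  exists U, cancel T U /\ cancel U T.
Proof.
have /asboolP[Tl Tj Tm [U TK UK]] := lattice_autP T.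
suff H : is_lattice_aut U by exists (MkLatticeAut (asboolT H)).
split=> [a f g|f g|f g|]; last by exists T.
- by apply: (can_inj TK); rewrite UK Tl !UK.
- by apply: (can_inj TK); rewrite UK Tj !UK.
- by apply: (can_inj TK); rewrite UK Tm !UK.
Qed.

Definition lattice_aut_one := MkLatticeAut (asboolT is_lattice_aut_id).
Definition lattice_aut_mul T U :=
  MkLatticeAut (asboolT (is_lattice_aut_comp T U)).
Definition lattice_aut_inv T := projT1 (cid (lattice_aut_has_inv T)).

Let mulA : associative lattice_aut_mul.
Proof. by move=> T U V; exact: lattice_aut_ext. Qed.
Let mul1 : left_id lattice_aut_one lattice_aut_mul.
Proof. by move=> T; exact: lattice_aut_ext. Qed.
Let mulr1 : right_id lattice_aut_one lattice_aut_mul.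
Proof. by move=> T; exact: lattice_aut_ext. Qed.
Let mulV : left_inverse lattice_aut_one lattice_aut_inv lattice_aut_mul.
Proof.
move=> T; apply: lattice_aut_ext.
by rewrite /lattice_aut_inv; case: cid => U /= [].
Qed.
Let mulrV : right_inverse lattice_aut_one lattice_aut_inv lattice_aut_mul.
Proof.
move=> T; apply: lattice_aut_ext.
by rewrite /lattice_aut_inv; case: cid => U /= [].
Qed.

HB.instance Definition _ := isGroup.Build lattice_aut
  mulA mul1 mulr1 mulV mulrV.

End lattice_automorphisms.

Section homeomorphisms.
Context (Omega : topologicalType).

Definition is_homeo (phi : Omega -> Omega) := continuous phi /\
  exists psi, [/\ continuous psi, cancel phi psi & cancel psi phi].

Record homeo := MkHomeo {
  homeo_val :> Omega -> Omega;
  homeoP : `[< is_homeo homeo_val >] }.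

HB.instance Definition _ := [isSub for homeo_val].
HB.instance Definition _ := [Choice of homeo by <:].

Implicit Types phi psi : homeo.

Lemma homeo_ext phi psi : phi =1 psi -> phi = psi.
Proof. by move=> e; apply/val_inj/funext. Qed.

Lemma is_homeo_id : is_homeo id.
Proof. by split; [|exists id; split] => // x; exact: cvg_id. Qed.

Lemma is_homeo_comp phi psi : is_homeo (phi \o psi).
Proof.
have /asboolP[c1 [p1 [d1 k1 l1]]] := homeoP phi.
have /asboolP[c2 [p2 [d2 k2 l2]]] := homeoP psi.
split; first by move=> x; apply: continuous_comp; [exact: c2|exact: c1].
exists (p2 \o p1); split; [|exact: can_comp|exact: can_comp].
by move=> x; apply: continuous_comp; [exact: d1|exact: d2].
Qed.

Lemma homeo_has_inv phi : exists psi, cancel phi psi /\ cancel psi phi.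
Proof.
have /asboolP[c1 [p1 [d1 k1 l1]]] := homeoP phi.
have H : is_homeo p1 by split=> //; exists phi.
by exists (MkHomeo (asboolT H)).
Qed.

Definition homeo_one := MkHomeo (asboolT is_homeo_id).
Definition homeo_mul phi psi := MkHomeo (asboolT (is_homeo_comp phi psi)).
Definition homeo_inv phi := projT1 (cid (homeo_has_inv phi)).

Let mulA : associative homeo_mul.
Proof. by move=> *; exact: homeo_ext. Qed.
Let mul1 : left_id homeo_one homeo_mul.
Proof. by move=> *; exact: homeo_ext. Qed.
Let mulr1 : right_id homeo_one homeo_mul.
Proof. by move=> *; exact: homeo_ext. Qed.
Let mulV : left_inverse homeo_one homeo_inv homeo_mul.
Proof.
by move=> phi; apply: homeo_ext; rewrite /homeo_inv; case: cid => psi /= [].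
Qed.
Let mulrV : right_inverse homeo_one homeo_inv homeo_mul.
Proof.
by move=> phi; apply: homeo_ext; rewrite /homeo_inv; case: cid => psi /= [].
Qed.

HB.instance Definition _ := isGroup.Build homeo mulA mul1 mulr1 mulV mulrV.

End homeomorphisms.

Section decomposition.
Context (R : realType) (Omega : topologicalType).

Definition Cb_pp (m : Omega -> R) :=
  [/\ continuous m, exists M, forall x, `|m x| <= M &
      exists2 delta, 0 < delta & forall x, delta <= m x].

(* T = m phi, where phi acts by composition with its inverse *)
Definition is_factorization (T : lattice_aut R Omega) (m : Omega -> R)
    (phi : homeo Omega) :=
  forall (f : C0 R Omega) x, T f x = m x * f ((phi^-1)%g x).

(* The group homomorphism p. When Omega is locally compact and Hausdorff, the
   homeomorphism chosen here exists and is unique, so that the default value 1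
   is never used. *)
Definition homeo_part (T : lattice_aut R Omega) : homeo Omega :=
  xget 1%g [set phi | exists2 m, Cb_pp m & is_factorization T m phi].

End decomposition.

Section invariance.
Context (G : groupType) (R : realType) (Omega : topologicalType).

Definition homeo_invariant (pi : G -> homeo Omega) (S : set Omega) :=
  forall s, pi s @` S `<=` S.

Definition aut_invariant (rho : G -> lattice_aut R Omega)
    (I : set (C0 R Omega)) :=
  forall s, rho s @` I `<=` I.

End invariance.

(* Main.v *)
(* Let Z(J) be the set of common zeros of an order ideal J of C_0. A function
   with compact support disjoint from Z(J) is dominated by an element of J, so
   a closed ideal J is the vanishing ideal of Z(J); Urysohn functions give
   Z(I_S) = S for closed S.
   For a lattice automorphism T and a point x, the kernel of f |-> T f x is an
   order ideal whose common zero set is a single point sigma x, whence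
   T f x = m x * f (sigma x) with m x > 0. Applied to rho_s and rho_{s^-1} this
   gives rho_s f x = m x * f (pi_{s^-1} x), from which the equivalence of the
   two invariances is immediate.
   I_S is a band exactly when S is regularly closed: for regularly closed S an
   upper bound nonzero at an interior point of S can be lowered there, and
   conversely a function w supported off the closure of int S is the supremum
   of the elements of I_S below w. I_S is a projection band exactly when S is
   clopen, since functions disjoint from I_S live on S. *)

Require Import Defs.
From mathcomp Require Import all_boot all_order all_algebra.
From mathcomp Require Import all_classical all_reals all_analysis.
From mathcomp Require Import ring.

Set Implicit Arguments.
Unset Strict Implicit.
Unset Printing Implicit Defensive.

Import Order.TTheory GRing.Theory Num.Theory.
Import numFieldNormedType.Exports.

Local Open Scope classical_set_scope.
Local Open Scope ring_scope.

(** * Pointwise rules in [C0] and membership criteria *)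

Section C0_basics.
Context (R : realType) (Omega : topologicalType).
Local Notation E := (C0 R Omega).
Implicit Types (f g h : E) (a : R) (x : Omega) (u v : Omega -> R).

Lemma C0_0E x : (0 : E) x = 0. Proof. by []. Qed.
Lemma C0_addE f g x : (f + g) x = f x + g x. Proof. by []. Qed.
Lemma C0_oppE f x : (- f) x = - f x. Proof. by []. Qed.
Lemma C0_scaleE a f x : (a *: f) x = a * f x. Proof. by []. Qed.
Lemma C0_joinE f g x : (f `|` g)%O x = Num.max (f x) (g x). Proof. by []. Qed.
Lemma C0_meetE f g x : (f `&` g)%O x = Num.min (f x) (g x). Proof. by []. Qed.

Lemma C0_absE f x : C0_abs f x = `|f x|.
Proof.
rewrite /C0_abs C0_joinE C0_oppE; have [fx0|/ltW fx0] := leP 0 (f x).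
  by rewrite ger0_norm// max_l// ge0_cp.
by rewrite ler0_norm// max_r// le0_cp.
Qed.

Definition C0E := (C0_0E, C0_addE, C0_oppE, C0_scaleE, C0_absE, C0_joinE,
  C0_meetE).

Lemma C0_ge0 f x : 0 <= f -> 0 <= f x.
Proof. by move=> /C0_leP; exact. Qed.

Lemma C0_continuous f : continuous f.
Proof. by have [] := C0P f. Qed.

Definition C0_of u (uC0 : is_C0 u) : E := MkC0 (asboolT uC0).

Lemma closed_norm_ge u a : continuous u -> closed [set x | a <= `|u x|].
Proof.
move=> cu; apply: (preimage_closed _ (@closed_ge _ a)) => x _.
by apply: continuous_comp; [exact: cu|exact: norm_continuous].
Qed.

Lemma is_C0_dominated u v : continuous u -> is_C0 v ->
  (forall e : R, 0 < e ->
    exists2 d : R, 0 < d & forall x, e <= `|u x| -> d <= `|v x|) ->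
  is_C0 u.
Proof.
move=> cu [cv vv] uv; split=> // e e0; have [d d0 ed] := uv e e0.
exact: (subclosed_compact (closed_norm_ge cu) (vv d d0)).
Qed.

Lemma is_C0_le u v : continuous u -> is_C0 v -> (forall x, `|u x| <= `|v x|) ->
  is_C0 u.
Proof.
move=> cu vC uv; apply: (is_C0_dominated cu vC) => e e0; exists e => // x ex.
exact: le_trans ex (uv x).
Qed.

(** Closure of [C0] under uniform limits: continuity is the usual [e / 3] argument, and [e <= |u|]
    forces [e / 2 <= |f|] for an [e / 2]-approximant [f]. *)
Lemma is_C0_approx u :
  (forall e : R, 0 < e -> exists f, forall x, `|u x - f x| <= e) -> is_C0 u.
Proof.
move=> uf.
have cu : continuous u.
  move=> x; apply/cvgrPdist_le => e e0.
  have e3 : 0 < e / 3 by rewrite divr_gt0.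
  have [f uf3] := uf _ e3.
  have /cvgrPdist_le/(_ _ e3) := @C0_continuous f x.
  apply: filterS => y fxy.
  rewrite (_ : u x - u y = (u x - f x) + (f x - f y) - (u y - f y));
    last by ring.
  rewrite (_ : e = e / 3 + e / 3 + e / 3); last by field.
  apply: le_trans (ler_normB _ _) _; apply: lerD (uf3 y).
  by apply: le_trans (ler_normD _ _) _; exact: lerD.
split=> // e e0.
have e2 : 0 < e / 2 by rewrite divr_gt0.
have [f ufe] := uf _ e2; have [_ vf] := C0P f.
apply: (subclosed_compact (closed_norm_ge cu) (vf _ e2)) => x /= eux.
rewrite -(lerD2r (e / 2)) -splitr (le_trans eux)//.
have -> : u x = f x + (u x - f x) by rewrite addrC subrK.
by apply: le_trans (ler_normD _ _) _; rewrite lerD2l.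
Qed.

Lemma is_C0_sqrt f : is_C0 (fun x => Num.sqrt `|f x|).
Proof.
apply: (is_C0_dominated (v := f)); last 2 first.
- exact: C0P.
- move=> e e0; exists (e ^+ 2) => [|x]; first by rewrite exprn_gt0.
  rewrite ger0_norm ?sqrtr_ge0// => ex.
  by rewrite -(sqr_sqrtr (normr_ge0 (f x))) ler_sqr// nnegrE ?sqrtr_ge0// ltW.
move=> x; apply: continuous_comp; last exact: sqrt_continuous.
by apply: continuous_comp; [exact: C0_continuous|exact: norm_continuous].
Qed.

End C0_basics.

(** * Urysohn functions in [C0] *)

Section peak_functions.
Context (R : realType) (Omega : topologicalType).
Context (hOmega : hausdorff_space Omega).
Context (lcOmega : locally_compact [set: Omega]).
Local Notation E := (C0 R Omega).

Lemma C0_peak (x : Omega) (U : set Omega) : nbhs x U ->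
  exists f : E, [/\ f x = 1, forall y, 0 <= f y <= 1 &
                    forall y, ~ U y -> f y = 0].
Proof.
(* Intersecting [U] with a compact neighbourhood [K] makes the separating function vanish off [K],
   hence vanish at infinity. *)
move=> xU; have [K] := lcOmega (I : [set: Omega] x).
rewrite withinET => xK [cK _].
have UKx : nbhs x (U `&` K) by exact: filterI.
pose V := (U `&` K)^°.
have VUK : V `<=` U `&` K by exact: interior_subset.
have cV : closed (~` V) by exact/open_closedC/open_interior.
have nVx : ~ (~` V) x by apply; exact: nbhs_singleton (nbhs_interior UKx).
have [g [cg g01 g0 g1]] := (@uniform_separatorP _ R _ _).1
  (@locally_compact_completely_regular _ R lcOmega hOmega x _ cV nVx).
have gV y : ~ V y -> g y = 1 by move=> Vy; apply: g1; exists y.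
have c1g : continuous (fun y => 1 - g y).
  by move=> y; apply: cvgB; [exact: cvg_cst|exact: cg].
have C0g : is_C0 (fun y => 1 - g y).
  split=> // e e0; apply: (subclosed_compact (closed_norm_ge c1g) cK) => y /=.
  move=> ey; apply: contrapT => Ky; have /gV gy : ~ V y by move=> /VUK[].
  by move: ey; rewrite gy subrr normr0 leNgt e0.
exists (C0_of C0g); split=> [|y|y Uy] /=.
- by rewrite (_ : g x = 0) ?subr0//; apply: g0; exists x.
- have /= : g y \in `[0, 1] by apply: g01; exists y.
  by rewrite in_itv /= subr_ge0 lerBlDr lerDl => /andP[-> ->].
- by rewrite gV ?subrr// => /VUK[/Uy].
Qed.

Lemma C0_separate (x y : Omega) : (forall f : E, f x = f y) -> x = y.
Proof.
move=> fxy; apply: contrapT => xy.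
have yx : nbhs x (~` [set y]).
  apply: open_nbhs_nbhs; split=> //.
  by apply: closed_openC; exact/accessible_closed_set1/hausdorff_accessible.
have [f [fx _ f0]] := C0_peak yx.
have := fxy f; rewrite fx f0; last by apply.
by move=> /eqP; rewrite oner_eq0.
Qed.

End peak_functions.

(** * Domination on compact sets by elements of an order ideal *)

Section order_ideals.
Context (R : realType) (Omega : topologicalType).
Local Notation E := (C0 R Omega).
Implicit Types (f g h : E) (J : set E) (S K : set Omega).

Lemma order_ideal_le J f g : order_ideal J -> J g ->
  (forall x, `|f x| <= `|g x|) -> J f.
Proof.
move=> [_ _ _ sJ] Jg fg; apply: (sJ _ _ Jg); apply/C0_leP => x.
by rewrite !C0_absE.
Qed.

Lemma order_ideal_dominates_compact J K (u : Omega -> R) :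
  order_ideal J -> compact K -> continuous u ->
  (forall x, K x -> exists2 g, J g & g x != 0) ->
  exists2 g, J g & forall x, K x -> `|u x| <= g x.
Proof.
move=> iJ cK cu KJ; have [J0 JD JZ _] := iJ.
(* The filter of properties holding for all sufficiently large elements of [J]. Compactness, in its
   near-covering form, turns domination near each point into domination on all of [K]. *)
pose tail A := exists2 g : E, J g /\ 0 <= g & forall h, J h -> g <= h -> A h.
have tailF : Filter (tail : set_system E).
  split=> [|A B [f [Jf f0] fA] [g [Jg g0] gB]|A B AB [g Jg gA]].
  - by exists 0.
  - exists (f + g); first split; first exact: JD.
      by apply/C0_leP => x; rewrite addr_ge0//; exact: C0_ge0.
    move=> h Jh fgh; split.
      by apply: fA => //; apply: le_trans fgh; apply/C0_leP => x;
        rewrite lerDl; exact: C0_ge0.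
    by apply: gB => //; apply: le_trans fgh; apply/C0_leP => x;
      rewrite lerDr; exact: C0_ge0.
  - by exists g => // h Jh gh; exact/AB/gA.
have := (compact_near_coveringP K).1 cK E tail (fun g x => `|u x| <= g x) tailF.
case=> [x /KJ[g Jg gx]|g [Jg _] gK]; last by exists g => // x; exact: gK.
(* The scaling makes [k x] exceed [|u x|] by 1, so strict domination persists near [x]. *)
pose k := (`|u x| + 1) / `|g x| *: C0_abs g.
have kx : k x = `|u x| + 1 by rewrite !C0E divfK// normr_eq0.
have Jk : J k.
  apply: JZ; apply: (order_ideal_le iJ Jg) => y.
  by rewrite C0_absE normr_id.
have nk : \forall y \near x, `|u y| < k y.
  have : 0 < k x - `|u x| by rewrite kx addrAC subrr add0r.
  have cd : {for x, continuous (fun y => k y - `|u y|)}.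
    apply: cvgB; first exact: C0_continuous.
    by apply: continuous_comp; [exact: cu|exact: norm_continuous].
  move=> /(cvgr_gt _ cd); apply: filterS => y.
  by rewrite subr_gt0.
exists ([set y | `|u y| < k y], [set h | J h /\ k <= h]).
  split=> //=; exists k => //; split=> //; apply/C0_leP => y.
  by rewrite !C0E mulr_ge0// divr_ge0// addr_ge0.
move=> [y h] /= [uk [_ /C0_leP kh]].
exact: le_trans (ltW uk) (kh y).
Qed.

End order_ideals.

(** * Closed ideals and their common zeros *)

Section closed_ideals.
Context (R : realType) (Omega : topologicalType).
Local Notation E := (C0 R Omega).
Implicit Types (f g h : E) (J : set E) (S K : set Omega).

Definition common_zeros J := [set x | forall f, J f -> f x = 0].

Lemma closed_common_zeros J : closed (common_zeros J).
Proof.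
rewrite (_ : common_zeros J = \bigcap_(f in J) (f @^-1` [set 0])).
  apply: closed_bigI => f Jf; apply: (preimage_closed _ (@closed_eq _ _)).
  by move=> x _; exact: C0_continuous.
by apply/seteqP; split.
Qed.

Lemma order_ideal_compact_support J K f : order_ideal J -> compact K ->
  K `&` common_zeros J = set0 -> (forall x, ~ K x -> f x = 0) -> J f.
Proof.
move=> iJ cK KJ fK.
have [|g Jg fg] := order_ideal_dominates_compact iJ cK (@C0_continuous _ _ f).
  move=> x Kx; apply: contrapT => nJ.
  suff : (K `&` common_zeros J) x by rewrite KJ.
  split=> // g Jg; apply: contrapT => /eqP gx; apply: nJ.
  by exists g.
apply: (order_ideal_le iJ Jg) => x; have [Kx|/fK ->] := pselect (K x).
  exact: le_trans (fg x Kx) (ler_norm _).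
by rewrite normr0.
Qed.

(** The set where [e <= |f|] is compact, misses the common zeros because [f] vanishes there, and
    contains the support of [g]. *)
Lemma order_ideal_threshold J f g (e : R) : order_ideal J ->
  vanishing_ideal (common_zeros J) f -> 0 < e ->
  (forall x, `|f x| < e -> g x = 0) -> J g.
Proof.
move=> iJ Jf e0 fg; have [_ vf] := C0P f.
apply: (order_ideal_compact_support iJ (vf e e0)) => [|x /= /negP].
  apply/seteqP; split=> // x [/= ef /Jf fx].
  by move: ef; rewrite fx normr0 leNgt e0.
by rewrite -ltNge; exact: fg.
Qed.

Lemma C0_closureP J f : closure J f <->
  forall e : R, 0 < e -> exists2 g, J g & forall x, `|f x - g x| <= e.
Proof.
split=> [Jf e e0|Jf B].
  have [g [Jg]] := Jf _ (nbhsx_ballx f _ e0).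
  rewrite -ball_normE => /ltW fg; exists g => // x.
  exact: le_trans (C0_norm_ub (f - g) x) fg.
move=> /nbhs_ballP[e /= e0 eB].
have e2 : 0 < e / 2 by rewrite divr_gt0.
have [g Jg fg] := Jf _ e2; exists g; split=> //; apply: eB.
rewrite -ball_normE /=; apply: (@le_lt_trans _ _ (e / 2)).
  by apply: (C0_norm_le (ltW e2)) => x; exact: fg.
by rewrite ltr_pdivrMr// ltr_pMr// ltr1n.
Qed.

Lemma vanishing_ideal_closed_ideal S : closed_ideal (@vanishing_ideal R _ S).
Proof.
split.
  split=> [x //|f g fS gS x Sx|a f fS x Sx|f g gS /C0_leP fg x Sx].
  - by rewrite C0E fS// gS// addr0.
  - by rewrite C0E fS// mulr0.
  - apply/eqP; rewrite -normr_le0 -C0_absE (le_trans (fg x))//.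
    by rewrite C0_absE gS// normr0.
move=> f /C0_closureP fS x Sx; apply/eqP; rewrite -normr_le0.
apply/ler_addgt0Pl => e e0; have [g gS fg] := fS _ e0.
by have := fg x; rewrite gS// subr0 addr0.
Qed.

Lemma closed_ideal_common_zeros J : closed_ideal J ->
  vanishing_ideal (common_zeros J) = J.
Proof.
move=> [iJ cJ]; apply/seteqP; split=> f; last by move=> Jf x; exact.
move=> fJ; suff Jf : J (C0_abs f).
  by apply: (order_ideal_le iJ Jf) => x; rewrite C0_absE normr_id.
apply/cJ/C0_closureP => e e0.
(* The truncation of [|f|] at height [e] lies in [J] by the threshold lemma, even before closure is
   taken, and is within [e] of [|f|]. *)
have cu : continuous (fun x => Num.max 0 (`|f x| - e)).
  move=> x; apply: (@continuous_max _ _ (fun=> 0) (fun x => `|f x| - e)).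
    exact: cvg_cst.
  apply: cvgB; last exact: cvg_cst.
  by apply: continuous_comp; [exact: C0_continuous|exact: norm_continuous].
have uC0 : is_C0 (fun x => Num.max 0 (`|f x| - e)).
  apply: (is_C0_le cu (C0P f)) => x.
  by rewrite ger0_norm ?le_max ?lexx// ge_max normr_ge0 gerBl ltW.
exists (C0_of uC0).
  apply: (order_ideal_threshold iJ fJ e0) => x fe /=.
  by rewrite max_l// subr_le0 ltW.
move=> x; rewrite C0_absE /=; have [fe|fe] := leP `|f x| e.
  by rewrite max_l ?subr_le0// subr0 normr_id.
rewrite max_r ?subr_ge0 ?(ltW fe)//.
by rewrite opprB addrC subrK ger0_norm// ltW.
Qed.

End closed_ideals.

(** * Closed sets correspond to closed ideals *)

Section vanishing_ideal_bijection.
Context (R : realType) (Omega : topologicalType).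
Context (hOmega : hausdorff_space Omega).
Context (lcOmega : locally_compact [set: Omega]).

Lemma common_zeros_vanishing_ideal (S : set Omega) : closed S ->
  common_zeros (@vanishing_ideal R _ S) = S.
Proof.
move=> cS; apply/seteqP; split=> x; last by move=> Sx f; exact.
move=> xS; apply: contrapT => Sx.
have xU : nbhs x (~` S).
  by apply: open_nbhs_nbhs; split=> //; exact: closed_openC.
have [f [fx _ f0]] := C0_peak R hOmega lcOmega xU.
have /xS : vanishing_ideal S f by move=> y Sy; apply: f0; apply.
by rewrite fx => /eqP; rewrite oner_eq0.
Qed.

Lemma vanishing_ideal_bij :
  set_bij [set S | closed S] [set J | closed_ideal J]
    (@vanishing_ideal R Omega).
Proof.
split=> [S _|S S'|J iJ]; first exact: vanishing_ideal_closed_ideal.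
  rewrite !inE => /= cS cS' SS'.
  by rewrite -[LHS]common_zeros_vanishing_ideal// SS'
    common_zeros_vanishing_ideal.
exists (common_zeros J); first exact: closed_common_zeros.
exact: closed_ideal_common_zeros.
Qed.

End vanishing_ideal_bijection.

(** * Lattice functionals are positive multiples of evaluations *)

Section lattice_functionals.
Context (R : realType) (Omega : topologicalType).
Context (hOmega : hausdorff_space Omega).
Context (lcOmega : locally_compact [set: Omega]).
Local Notation E := (C0 R Omega).
Implicit Types (f g : E).

(* The kernel of [h] is an order ideal, possibly not closed a priori. The
   inequality [|f| <= e sqrt |f| + (|f| - e sqrt |f|)^+], whose last term has
   compact support, shows that the kernel contains every function vanishing at
   its common zeros, without using the continuity of positive functionals. *)
Lemma lattice_functional_eval (h : E -> R) :
  (forall (a : R) f g, h (a *: f + g) = a * h f + h g) ->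
  {morph h : f g / (f `&` g)%O >-> Num.min f g} ->
  (exists f, h f != 0) ->
  exists y c, 0 < c /\ forall f, h f = c * f y.
Proof.
move=> hl hm [f0 hf0].
have h0 : h 0 = 0 by have := hl (-1) 0 0; rewrite scaler0 addr0 mulN1r addNr.
have hZ a f : h (a *: f) = a * h f.
  by have := hl a f 0; rewrite addr0 h0 addr0.
have hD f g : h (f + g) = h f + h g by have := hl 1 f g; rewrite scale1r mul1r.
have hN f : h (- f) = - h f by rewrite -scaleN1r hZ mulN1r.
have habs f : h (C0_abs f) = `|h f|.
  have -> : C0_abs f = - (f `&` - f)%O.
    by apply: C0_ext => x; rewrite C0_absE !C0E oppr_min opprK maxC maxrN.
  by rewrite hN hm hN oppr_min opprK maxC maxrN.
have hle f g : f <= g -> h f <= h g.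
  by move=> /meet_idPl fg; rewrite -fg hm ge_min lexx orbT.
pose J := [set f | h f = 0].
have iJ : order_ideal J.
  split=> [//|f g /= hf hg|a f /= hf|f g /= hg fg].
  - by rewrite /J /= hD hf hg addr0.
  - by rewrite /J /= hZ hf mulr0.
  - apply/eqP; rewrite -normr_le0 -habs (le_trans (hle _ _ fg))// habs.
    by rewrite hg normr0.
have vJ : vanishing_ideal (common_zeros J) `<=` J.
  move=> f fJ; apply/eqP; rewrite -normr_le0 -habs; apply/ler_addgt0Pl => e e0.
  pose s := C0_of (is_C0_sqrt f).
  have s0 : 0 <= s by apply/C0_leP => x; exact: sqrtr_ge0.
  have hs0 : 0 <= h s by rewrite -h0; exact: hle.
  (* Chosen so that [d * h s <= e]; the added 1 keeps the denominator positive when [h s = 0]. *)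
  pose d := e / (h s + 1).
  have d0 : 0 < d by rewrite divr_gt0// ltr_wpDl.
  pose u : E := ((0 : E) `|` (C0_abs f - d *: s : E))%O.
  have Ju : J u.
    (* Where [|f x| < d ^+ 2], one has [sqrt |f x| <= d], so [|f x| <= d * sqrt |f x|] and [u]
       vanishes. *)
    apply: (order_ideal_threshold iJ fJ (exprn_gt0 2 d0)) => x fxd.
    rewrite !C0E max_l// subr_le0 -[X in X <= _](sqr_sqrtr (normr_ge0 _)) expr2.
    rewrite ler_wpM2r ?sqrtr_ge0//.
    rewrite -ler_sqr ?nnegrE ?sqrtr_ge0 ?(ltW d0)// sqr_sqrtr//.
    exact: ltW.
  apply: (@le_trans _ _ (h (d *: s + u))).
    apply: hle; apply/C0_leP => x.
    by rewrite C0_addE -lerBlDl /u !C0E le_max lexx orbT.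
  rewrite hl Ju !addr0 /d mulrAC ler_pdivrMr ?ltr_wpDl//.
  by rewrite ler_wpM2l ?(ltW e0)// lerDl.
have [y yS] : common_zeros J !=set0.
  apply/set0P/negP => /eqP S0; move/eqP: hf0; apply.
  by apply: vJ; rewrite S0.
have Sy z : common_zeros J z -> z = y.
  move=> zS; apply: hOmega => U V Uz Vy.
  apply: contrapT => UV.
  have [f [fz f01 fU]] := C0_peak R hOmega lcOmega Uz.
  have [g [gy g01 gV]] := C0_peak R hOmega lcOmega Vy.
  (* Peaks on disjoint neighbourhoods have meet 0, so [h] kills one of them; that peak is then in
     [J] yet equals 1 at a common zero. *)
  have fg0 : (f `&` g)%O = 0.
    apply: C0_ext => x; rewrite !C0E.
    have /andP[fx _] := f01 x; have /andP[gx _] := g01 x.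
    have [Ux|/fU->] := pselect (U x); last by rewrite min_l.
    rewrite gV ?min_r// => Vx; apply: UV.
    by exists x.
  have := hm f g; rewrite fg0 h0 minElt => /esym; case: ifP => _.
    by move=> /zS; rewrite fz => /eqP; rewrite oner_eq0.
  by move=> /yS; rewrite gy => /eqP; rewrite oner_eq0.
have [w [wy w01 _]] := C0_peak R hOmega lcOmega (@filterT _ (nbhs y) _).
have hE f : h f = h w * f y.
  have : J (f - f y *: w).
    by apply: vJ => z /Sy ->; rewrite !C0E wy mulr1 subrr.
  by move=> /= /eqP; rewrite hD hN hZ subr_eq0 mulrC => /eqP.
exists y, (h w); split=> //.
rewrite lt_neqAle; apply/andP; split; last first.
  by rewrite -h0; apply: hle; apply/C0_leP => x; have /andP[] := w01 x.
by apply: contra_neq hf0 => /esym hw; rewrite hE hw mul0r.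
Qed.

Lemma lattice_aut_weighted_composition (T : lattice_aut R Omega) :
  exists m : Omega -> R, exists sigma : Omega -> Omega,
    (forall x, 0 < m x) /\ forall f x, T f x = m x * f (sigma x).
Proof.
have /asboolP[Tl _ Tm [U _ UK]] := lattice_autP T.
have H x : exists p : R * Omega, 0 < p.1 /\ forall f, T f x = p.1 * f p.2.
  have [||/=|y [c [c0 Tx]]] := @lattice_functional_eval (fun f => T f x).
  - by move=> a f g; rewrite Tl.
  - by move=> f g; rewrite Tm.
  - have [f [fx _ _]] := C0_peak R hOmega lcOmega (@filterT _ (nbhs x) _).
    by exists (U f); rewrite UK fx oner_neq0.
  - by exists (c, y).
have [F FP] := choice H.
exists (fun x => (F x).1), (fun x => (F x).2).
by split=> [x|f x]; have [] := FP x.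
Qed.

End lattice_functionals.

(** * Boundedness and continuity of the weight and of the point map *)

Section weighted_compositions.
Context (R : realType) (Omega : topologicalType).
Context (hOmega : hausdorff_space Omega).
Context (lcOmega : locally_compact [set: Omega]).
Local Notation E := (C0 R Omega).
Implicit Types (f g : E).

(** The pointwise supremum of the weighted functions works: it is within [2 ^- N] of the join of 0
    and the first [N] terms, so it is a uniform limit of elements of [C0]. *)
Lemma C0_geometric_majorant (f_ : nat -> E) :
  (forall k x, 0 <= f_ k x <= 1) ->
  exists f : E, forall k x, 2 ^- k * f_ k x <= f x.
Proof.
move=> f01; pose F x := sup (range (fun k => 2 ^- k * f_ k x)).
have F0 k x : 0 <= 2 ^- k * f_ k x.
  by have /andP[? _] := f01 k x; rewrite mulr_ge0// invr_ge0 exprn_ge0.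
have F1 k x : 2 ^- k * f_ k x <= 2 ^- k.
  by have /andP[_ ?] := f01 k x; rewrite ler_piMr// invr_ge0 exprn_ge0.
have V2 N k : (N <= k)%N -> 2 ^- k <= 2 ^- N :> R.
  by move=> Nk; rewrite lef_pV2 ?posrE ?exprn_gt0// ler_eXn2l// ltr1n.
have uF x : has_ubound (range (fun k => 2 ^- k * f_ k x)).
  exists 1 => _ [k _ <-]; apply: le_trans (F1 k x) _.
  by apply: le_trans (V2 0%N k _) _; rewrite ?expr0 ?invr1.
have kF k x : 2 ^- k * f_ k x <= F x by apply: (ub_le_sup (uF x)); exists k.
suff FC0 : is_C0 F by exists (C0_of FC0).
pose G := fix G N : E := if N is k.+1 then (G k `|` (2 ^- k *: f_ k))%O else 0.
have GS N x : G N.+1 x = Num.max (G N x) (2 ^- N * f_ N x) by [].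
have GF N x : 0 <= G N x <= F x.
  elim: N => [|N /andP[G0 GF]].
    by rewrite lexx (le_trans (F0 0%N x) (kF 0%N x)).
  by rewrite GS le_max G0 ge_max GF kF.
have kG N k x : (k < N)%N -> 2 ^- k * f_ k x <= G N x.
  elim: N => // N IH; rewrite ltnS leq_eqVlt => /predU1P[->|/IH kN];
    rewrite GS le_max ?lexx ?orbT//.
  by rewrite kN.
have FG N x : F x <= G N x + 2 ^- N.
  have /andP[G0 _] := GF N x.
  apply: ge_sup; first by exists (2 ^- 0 * f_ 0 x), 0%N.
  move=> _ [k _ <-]; have [kN|Nk] := ltnP k N.
    by rewrite (le_trans (kG N k x kN))// lerDl invr_ge0 exprn_ge0.
  by apply: le_trans (F1 k x) _; apply: le_trans (V2 _ _ Nk) _; rewrite lerDr.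
apply: is_C0_approx => e e0.
have [N Ne] : exists N, 2 ^- N <= e.
  exists (Num.bound e^-1).
  rewrite -[leRHS]invrK lef_pV2 ?posrE ?exprn_gt0 ?invr_gt0//.
  apply: (@le_trans _ _ (Num.bound e^-1)%:R).
    by apply/ltW/archi_boundP; rewrite invr_ge0 ltW.
  by rewrite -natrX ler_nat; apply/ltnW/ltn_expl.
exists (G N) => x; have /andP[_ GFx] := GF N x.
rewrite ger0_norm ?subr_ge0// lerBlDl.
by apply: le_trans (FG N x) _; rewrite lerD2l.
Qed.

Context (T : E -> E) (m : Omega -> R) (sigma : Omega -> Omega).
Context (m0 : forall x, 0 < m x).
Context (TE : forall f x, T f x = m x * f (sigma x)).

(* If [m (x_ k) > 4 ^ k], then [T] cannot be applied to a function [f] in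
   [C0] with [f (sigma (x_ k)) >= 2 ^- k]. *)
Lemma weight_bounded : exists M, forall x, m x <= M.
Proof.
apply: contrapT => mM.
have H k : exists x, 4 ^+ k < m x.
  apply: contrapT => mk; apply: mM; exists (4 ^+ k) => x.
  by rewrite leNgt; apply/negP => mx; apply: mk; exists x.
have [x_ mx] := choice H.
have H' k : exists f : E, f (sigma (x_ k)) = 1 /\ forall y, 0 <= f y <= 1.
  have [f [? ? _]] :=
    C0_peak R hOmega lcOmega (@filterT _ (nbhs (sigma (x_ k))) _).
  by exists f.
have [f_ fP] := choice H'.
have [|f ff] := @C0_geometric_majorant f_.
  by move=> k; have [] := fP k.
have Tf k : 2 ^+ k <= C0_norm (T f).
  apply: (@le_trans _ _ `|T f (x_ k)|); last exact: C0_norm_ub.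
  apply: le_trans (ler_norm _); rewrite TE.
  have fk : 2 ^- k <= f (sigma (x_ k)).
    by have := ff k (sigma (x_ k)); have [-> _] := fP k; rewrite mulr1.
  apply: (@le_trans _ _ (4 ^+ k * 2 ^- k)).
    by rewrite (_ : 4 = 2 * 2 :> R) ?exprMn ?mulfK ?expf_neq0// -natrM.
  by apply: ler_pM => //; rewrite ?invr_ge0 ?exprn_ge0// ltW.
pose N := Num.bound (C0_norm (T f)).
have := Tf N; apply/negP; rewrite -ltNge.
apply: (@lt_trans _ _ N%:R); first exact: archi_boundP (C0_norm_ge0 _).
by rewrite -natrX ltr_nat ltn_expl.
Qed.

(** For a peak [f] at [sigma x] vanishing off [U], positivity of [T f] at [y] forces [sigma y] into
    [U], and it is an open condition. *)
Lemma weighted_composition_continuous : continuous sigma.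
Proof.
move=> x U Ux; have [f [fx _ fU]] := C0_peak R hOmega lcOmega Ux.
have Tfx : 0 < T f x by rewrite TE fx mulr1.
have Tf0 : \forall y \near x, 0 < T f y.
  exact: cvgr_gt (@C0_continuous _ _ (T f) x) _ Tfx.
suff : nbhs x (sigma @^-1` U) by [].
move: Tf0; apply: filterS => y Tfy; apply: contrapT => /fU fy.
by move: Tfy; rewrite TE fy mulr0 ltxx.
Qed.

Lemma weight_continuous : continuous m.
Proof.
move=> x.
have [f [fx _ _]] := C0_peak R hOmega lcOmega (@filterT _ (nbhs (sigma x)) _).
have cf : {for x, continuous (f \o sigma)}.
  apply: continuous_comp; last exact: C0_continuous.
  exact: weighted_composition_continuous.
have fx0 : 0 < (f \o sigma) x by rewrite /= fx.
(* Near [x] the weight is a quotient of continuous functions with nonzero denominator. *)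
have mE : {near x, (fun y => T f y / f (sigma y)) =1 m}.
  have f0 : \forall y \near x, 0 < f (sigma y) by exact: cvgr_gt cf _ fx0.
  move: f0; apply: filterS => y /= fy.
  by rewrite TE mulfK// gt_eqF.
apply: cvg_trans (near_eq_cvg mE) _.
rewrite -(nbhs_singleton mE).
apply: cvgM; first exact: C0_continuous.
by apply: cvgV cf; rewrite gt_eqF.
Qed.

End weighted_compositions.

(** * Factorization of lattice automorphisms *)

Section automorphisms.
Context (R : realType) (Omega : topologicalType).
Context (hOmega : hausdorff_space Omega).
Context (lcOmega : locally_compact [set: Omega]).
Local Notation E := (C0 R Omega).
Implicit Types (T : lattice_aut R Omega).

Lemma homeoVK (phi : homeo Omega) x : phi ((phi^-1)%g x) = x.
Proof. exact: (congr1 (fun psi : homeo Omega => psi x) (mulgV phi)). Qed.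

Lemma weighted_composition_id (m : Omega -> R) (sigma : Omega -> Omega) x y :
  (forall f : E, f y = m x * f (sigma x)) -> sigma x = y /\ m x = 1.
Proof.
move=> H.
have [w [wy w01 _]] := C0_peak R hOmega lcOmega (@filterT _ (nbhs y) _).
have [v [vy v01 _]] := C0_peak R hOmega lcOmega (@filterT _ (nbhs (sigma x)) _).
have m1 : m x = 1.
  (* Peaks have values in [[0, 1]]: the peak [v] at [sigma x] gives [m x = v y <= 1], and the peak
     [w] at [y] gives [1 = m x * w (sigma x) <= m x]. *)
  apply/eqP; rewrite eq_le; apply/andP; split.
    have := H v; rewrite vy mulr1 => <-.
    by have /andP[] := v01 y.
  have := H w; rewrite wy => ->.
  have /andP[w0 w1] := w01 (sigma x).
  have : 0 <= m x.
    by have := H v; rewrite vy mulr1 => <-; have /andP[] := v01 y.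
  by move=> mx0; rewrite ler_piMr.
split=> //; apply: (@C0_separate R _ hOmega lcOmega) => f.
by rewrite H m1 mul1r.
Qed.

(** Both [T] and its inverse are weighted compositions; comparing their composites with the identity
    makes the point maps mutually inverse and the weights reciprocal. An upper bound for one weight
    is thus a lower bound for the other. *)
Lemma lattice_aut_factorization T : exists phi : homeo Omega,
  exists2 m, Cb_pp m & is_factorization T m phi.
Proof.
have [U [TK UK]] := lattice_aut_has_inv T.
have [m [sigma [m0 TE]]] :=
  lattice_aut_weighted_composition hOmega lcOmega T.
have [n [tau [n0 UE]]] :=
  lattice_aut_weighted_composition hOmega lcOmega U.
have mn x : tau (sigma x) = x /\ m x * n (sigma x) = 1.
  apply: (@weighted_composition_id (fun x => m x * n (sigma x))
    (tau \o sigma)) => f.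
  by rewrite -{1}[f]UK TE UE mulrA.
have nm x : sigma (tau x) = x /\ n x * m (tau x) = 1.
  apply: (@weighted_composition_id (fun x => n x * m (tau x))
    (sigma \o tau)) => f.
  by rewrite -{1}[f]TK UE TE mulrA.
have csigma := weighted_composition_continuous hOmega lcOmega m0 TE.
have ctau := weighted_composition_continuous hOmega lcOmega n0 UE.
have htau : is_homeo tau.
  by split=> //; exists sigma; split=> // x; [have [] := nm x|have [] := mn x].
(* A homeomorphism acts through its inverse, so [phi] is [tau] rather than [sigma]. *)
pose phi := MkHomeo (asboolT htau).
exists phi, m; last first.
  move=> f x; rewrite TE; congr (_ * f _).
  by rewrite -{1}[x](homeoVK phi); have [] := nm ((phi^-1)%g x).
have [M mM] := weight_bounded hOmega lcOmega TE.
have [N nN] := weight_bounded hOmega lcOmega UE.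
split.
- exact: (weight_continuous hOmega lcOmega m0 TE).
- by exists M => x; rewrite gtr0_norm.
(* On an empty space [N] may fail to be positive, hence [|N| + 1]. *)
- have N1 : 0 < `|N| + 1 by rewrite ltr_wpDl.
  exists (`|N| + 1)^-1; first by rewrite invr_gt0.
  move=> x; have [_ mnx] := mn x.
  have -> : m x = (n (sigma x))^-1.
    by apply: (mulIf (lt0r_neq0 (n0 (sigma x)))); rewrite mnx mulVf ?gt_eqF.
  rewrite lef_pV2 ?posrE//.
  by rewrite (le_trans (nN _))// (le_trans (ler_norm _))// lerDl.
Qed.

Lemma homeo_partP T :
  exists2 m, Cb_pp m & is_factorization T m (homeo_part T).
Proof.
rewrite /homeo_part; case: xgetP => [phi _ //|H].
by have [phi /H] := lattice_aut_factorization T.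
Qed.

End automorphisms.

(** * Invariance of closed sets and of their ideals *)

Section invariant_ideals.
Context (R : realType) (Omega : topologicalType).
Context (hOmega : hausdorff_space Omega).
Context (lcOmega : locally_compact [set: Omega]).
Context (G : groupType) (rho : {multiplicative G -> lattice_aut R Omega}).
Local Notation E := (C0 R Omega).
Local Notation pi := (homeo_part (Omega := Omega) \o rho).

Lemma representationE (s : G) : exists2 m : Omega -> R,
  forall x, 0 < m x & forall f x, rho s f x = m x * f (pi (s^-1)%g x).
Proof.
have [m [_ _ [d d0 dm]] mE] := homeo_partP hOmega lcOmega (rho s).
have [n _ nE] := homeo_partP hOmega lcOmega (rho s^-1%g).
exists m => [x|f x]; first exact: lt_le_trans (dm x).
rewrite mE; congr (_ * f _).
pose phi := pi s; pose psi := pi s^-1%g.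
have rho1 : rho 1%g = 1%g.
  by apply: (mulgI (rho 1%g)); rewrite -gmulfM !mulg1.
have rhoV : (1 = rho s * rho s^-1)%g by rewrite -gmulfM mulgV rho1.
(* Expanding [rho s * rho s^-1 = 1] gives the instance of multiplicativity of [p] at stake: the
   inverse of [pi s] agrees with [pi s^-1] at [x]. *)
have mn (g : E) : g x =
    m x * n ((phi^-1)%g x) * g ((psi^-1)%g ((phi^-1)%g x)).
  rewrite -mulrA -nE -mE.
  exact: (congr1 (fun T : lattice_aut R Omega => T g x) rhoV).
have [psiphi _] := @weighted_composition_id R _ hOmega lcOmega
  (fun x => m x * n ((phi^-1)%g x)) (fun x => (psi^-1)%g ((phi^-1)%g x)) x x mn.
by rewrite -[LHS](homeoVK psi) psiphi.
Qed.

Lemma vanishing_ideal_invariant (S : set Omega) : closed S ->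
  homeo_invariant pi S <-> aut_invariant rho (vanishing_ideal S).
Proof.
move=> cS; split=> H s.
  move=> _ [f fS <-] x Sx; have [m _ ->] := representationE s.
  by rewrite fS ?mulr0//; apply: (H s^-1%g); exists x.
(* A point lies in [S] as soon as every function of the ideal vanishes there; the nonzero weight can
   be cancelled. *)
move=> _ [x Sx <-]; rewrite -(common_zeros_vanishing_ideal R hOmega lcOmega cS).
move=> f fS; have [m m0 mE] := representationE s^-1%g.
have : rho s^-1%g f x = 0 by apply: (H s^-1%g) => //; exists f.
by rewrite mE invgK => /eqP; rewrite mulf_eq0 gt_eqF//= => /eqP.
Qed.

End invariant_ideals.

(** * Bands and projection bands *)

Section bands.
Context (R : realType) (Omega : topologicalType).
Local Notation E := (C0 R Omega).
Implicit Types (f g h : E) (S : set Omega) (B : set E).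

(* If [b] in [B] is uniformly within [e] of [f], then [|f| /\ |b|] is an
   element of [B] below [|f|] and above [|f| - e]; hence [|f|] is a supremum of
   elements of [B]. *)
Lemma band_closed_ideal B : band B -> closed_ideal B.
Proof.
move=> [iB sB]; split=> // f /C0_closureP fB.
suff Bf : B (C0_abs f).
  by apply: (order_ideal_le iB Bf) => x; rewrite C0_absE normr_id.
apply: (sB [set g | B g /\ g <= C0_abs f]) => [g []//|].
split=> [g []//|u uB]; apply/C0_leP => x; apply/ler_addgt0Pl => e e0.
have [b Bb fb] := fB _ e0.
have : (C0_abs f `&` C0_abs b)%O <= u.
  apply: uB; split; last exact: leIl.
  apply: (order_ideal_le iB Bb) => y.
  by rewrite !C0E ger0_norm ?ge_min ?lexx ?orbT// le_min !normr_ge0.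
move=> /C0_leP/(_ x); rewrite !C0E => fbu.
rewrite -lerBlDl (le_trans _ fbu)// le_min.
rewrite gerBl (ltW e0) lerBlDr -lerBlDl.
exact: le_trans (lerB_dist _ _) (fb x).
Qed.

Context (hOmega : hausdorff_space Omega).
Context (lcOmega : locally_compact [set: Omega]).

Lemma regclosed_vanishing_ideal_band S :
  regclosed S -> band (@vanishing_ideal R _ S).
Proof.
move=> rS; split; first by have [] := @vanishing_ideal_closed_ideal R _ S.
move=> D f DS [fD Df].
suff fS0 x : S^° x -> f x = 0.
  move=> x; rewrite -rS => Sx.
  have : closed (f @^-1` [set 0]).
    by apply: (preimage_closed _ (@closed_eq _ _)) => y _; exact: C0_continuous.
  by apply; apply: closureS Sx => y; exact: fS0.
move=> Sx; have [w [wx w01 wS]] := C0_peak R hOmega lcOmega Sx.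
(* The lowered function still bounds [D]: elements of [D] vanish on [S], where therefore [0 <= f],
   and [w] vanishes off [S]. *)
have : f <= f - (C0_abs f `&` w)%O.
  apply: Df => d Dd; apply/C0_leP => y.
  have := C0_leP _ _ (fD d Dd) y; rewrite !C0E.
  have [Sy|/wS ->] := pselect (S y); last first.
    by rewrite min_r ?subr0.
  rewrite (DS d Dd)// => fy; rewrite subr_ge0 ge_min ger0_norm//.
  by rewrite lexx.
move=> /C0_leP/(_ x); rewrite !C0E wx lerDl oppr_ge0 ge_min.
by rewrite ler10 orbF normr_le0 => /eqP.
Qed.

Lemma vanishing_ideal_band_regclosed S : closed S ->
  band (@vanishing_ideal R _ S) -> regclosed S.
Proof.
move=> cS [_ bS]; apply/seteqP; split=> x.
  by rewrite {2}(closure_id S).1//; apply: closureS; exact: interior_subset.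
move=> Sx; apply: contrapT => nSx.
have xU : nbhs x (~` closure S^°).
  by apply: open_nbhs_nbhs; split=> //; exact/closed_openC/closed_closure.
have [w [wx w01 wU]] := C0_peak R hOmega lcOmega xU.
suff /(_ x Sx) : vanishing_ideal S w by rewrite wx => /eqP; rewrite oner_eq0.
apply: (bS [set d | vanishing_ideal S d /\ d <= w]) => [d []//|].
split=> [d []//|u uD].
(* Off [S], the meet of [w] with a peak at [y] vanishing on [S] belongs to the family and equals [w]
   at [y]. On the interior of [S], [w] is 0; the remaining points are limits of points off [S]. *)
have wuC y : ~ S y -> w y <= u y.
  move=> Sy; have [|v [vy v01 vS]] := @C0_peak R _ hOmega lcOmega y (~` S).
    by apply: open_nbhs_nbhs; split=> //; exact: closed_openC.
  have : (w `&` v)%O <= u.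
    apply: uD; split; last exact: leIl.
    move=> z Sz; rewrite !C0E vS; last by apply.
    by rewrite min_r//; have /andP[] := w01 z.
  move=> /C0_leP/(_ y); rewrite C0E vy min_l//.
  by have /andP[] := w01 y.
apply/C0_leP => y; have [Sy|nSy] := pselect (S^° y).
  rewrite wU; last by apply; exact: subset_closure.
  have : 0 <= u.
    by apply: uD; split=> //; apply/C0_leP => z; have /andP[] := w01 z.
  exact: C0_ge0.
have : closure (~` S) y by rewrite closure_setC.
have : closed [set z | w z <= u z].
  rewrite (_ : mkset _ = (fun z => u z - w z) @^-1` [set t | 0 <= t]).
    apply: (preimage_closed _ (@closed_ge _ 0)) => z _.
    exact: (@C0_continuous _ _ (u - w)).
  by apply/seteqP; split=> z /=; rewrite subr_ge0.
move=> cl Sy; apply: cl; apply: closureS Sy; exact: wuC.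
Qed.

Lemma clopen_regclosed S : clopen S -> regclosed S.
Proof.
by move=> [oS cS]; rewrite /regclosed (interior_id S).1// -(closure_id S).1.
Qed.

(** Near each point the restriction agrees with [f] or with 0, since both [S] and its complement are
    open. *)
Lemma is_C0_clopen_restrict f S : clopen S ->
  is_C0 (fun x => if `[< S x >] then f x else 0).
Proof.
move=> [oS cS].
have c : continuous (fun x => if `[< S x >] then f x else 0).
  move=> x; have [Sx|Sx] := pselect (S x).
    apply: (@cvg_trans _ (f y @[y --> x])); last first.
      by rewrite asboolT//; exact: C0_continuous.
    apply: near_eq_cvg; near=> y; rewrite asboolT//; near: y.
    exact: open_nbhs_nbhs.
  rewrite /continuous_at asboolF//.
  apply: (@cvg_trans _ ((fun=> 0 : R) y @[y --> x])); last exact: cvg_cst.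
  apply: near_eq_cvg; near=> y; rewrite asboolF//; near: y.
  by apply: open_nbhs_nbhs; split=> //; exact: closed_openC.
apply: (is_C0_le c (C0P f)) => x.
by case: ifP => // _; rewrite normr0.
Unshelve. all: by end_near. Qed.

Lemma clopen_vanishing_ideal_projection_band S :
  clopen S -> projection_band (@vanishing_ideal R _ S).
Proof.
move=> oS; split.
  exact/regclosed_vanishing_ideal_band/clopen_regclosed.
move=> f; pose h : E := C0_of (is_C0_clopen_restrict f oS).
have hS x : S x -> h x = f x by move=> Sx; rewrite /= asboolT.
have hSC x : ~ S x -> h x = 0 by move=> Sx; rewrite /= asboolF.
exists (f - h), h; split; last by rewrite subrK.
  by move=> x Sx; rewrite !C0E hS// subrr.
move=> g gS; apply: C0_ext => x; rewrite !C0E.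
have [/gS ->|/hSC ->] := pselect (S x).
  by rewrite normr0 min_r.
by rewrite normr0 min_l.
Qed.

Lemma vanishing_ideal_projection_band_clopen S : closed S ->
  projection_band (@vanishing_ideal R _ S) -> clopen S.
Proof.
move=> cS [_ pS]; split=> //; rewrite openE => x Sx.
have [w [wx _ _]] := C0_peak R hOmega lcOmega (@filterT _ (nbhs x) _).
(* At [x] the component [g] vanishes, so [h x = 1]. Disjointness of [h] from peaks off [S] puts the
   open set where [0 < h] inside [S]. *)
have [g [h [gS hS whg]]] := pS w.
have hx : 0 < h x.
  by have := congr1 (fun k : E => k x) whg; rewrite C0E gS// add0r wx => <-.
have hpos : \forall y \near x, 0 < h y.
  exact: cvgr_gt (@C0_continuous _ _ h x) _ hx.
rewrite /interior; move: hpos; apply: filterS => y hy; apply: contrapT => Sy.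
have [|v [vy v01 vS]] := @C0_peak R _ hOmega lcOmega y (~` S).
  by apply: open_nbhs_nbhs; split=> //; exact: closed_openC.
have vI : vanishing_ideal S v by move=> z Sz; apply: vS; apply.
have := congr1 (fun k : E => k y) (hS v vI); rewrite !C0E vy normr1.
have : 0 < Num.min `|h y| 1 by rewrite lt_min ltr01 normr_gt0 gt_eqF.
by move=> + h0; rewrite h0 ltxx.
Qed.

End bands.

(** * Restricting the bijection *)

Lemma set_bij_restrict (T U : Type) (A A' : set T) (B B' : set U)
    (f : T -> U) : set_bij A B f -> A' `<=` A -> B' `<=` B ->
  (forall x, A x -> A' x <-> B' (f x)) -> set_bij A' B' f.
Proof.
move=> [_ fi fs] A'A B'B AB; split=> [x A'x|x y|y B'y].
- by apply/AB => //; exact: A'A.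
- by rewrite !inE => /A'A Ax /A'A Ay; apply: fi; rewrite inE.
- have [x Ax xy] := fs _ (B'B _ B'y); exists x => //.
  by apply/AB => //; rewrite xy.
Qed.

Local Close Scope ring_scope.

Theorem proposition6p7 (R : realType) (Omega : topologicalType)
    (hOmega : hausdorff_space Omega) (lcOmega : locally_compact [set: Omega])
    (G : groupType) (rho : {multiplicative G -> lattice_aut R Omega}) :
  let pi : G -> homeo Omega := homeo_part (Omega := Omega) \o rho in
  let I := @vanishing_ideal R Omega in
  [/\ set_bij [set S | closed S] [set J | closed_ideal J] I,
      set_bij [set S | closed S /\ homeo_invariant pi S]
              [set J | closed_ideal J /\ aut_invariant rho J] I,
      set_bij [set S | regclosed S /\ homeo_invariant pi S]
              [set B | band B /\ aut_invariant rho B] I &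
      set_bij [set S | clopen S /\ homeo_invariant pi S]
              [set B | projection_band B /\ aut_invariant rho B] I].
Proof.
move=> pi I.
have bij : set_bij [set S | closed S] [set J | closed_ideal J] I.
  exact: vanishing_ideal_bij.
have inv S : closed S -> homeo_invariant pi S <-> aut_invariant rho (I S).
  exact: vanishing_ideal_invariant.
(* Each restriction reduces to two inclusions, into closed sets and into closed ideals, and an
   equivalence of properties for a closed [S]. *)
split=> //; apply: (set_bij_restrict bij) => [S []//|J []//|S /= cS].
- split=> -[? ?]; split=> //; try exact/inv.
  exact: vanishing_ideal_closed_ideal.
- by move=> <- _; exact: closed_closure.
- by move=> bJ _; exact: band_closed_ideal.
- split=> -[? ?]; split; try exact/inv.
    exact: regclosed_vanishing_ideal_band.
  exact: (@vanishing_ideal_band_regclosed R).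
- by case.
- by case=> bJ _ _; exact: band_closed_ideal.
- split=> -[? ?]; split; try exact/inv.
    exact: clopen_vanishing_ideal_projection_band.
  exact: (@vanishing_ideal_projection_band_clopen R).
Qed.
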